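(* Let $1<p,q<\infty$ with $\frac1p+\frac1q=1$, and let $J:l_p\to l_q$ be the normalized duality mapping of the real Banach space $l_p$. Let $x\in l_p\setminus\{\theta\}$. For any $a>0$ with $a\neq 1$, we have $$aJ(x)\notin\widehat{D}^*J(x)(x).$$
   Context: $l_p$ and $l_q$ are the real sequence spaces with norms $\|\cdot\|_p$, $\|\cdot\|_q$; $l_p^*=l_q$, $l_q^*=l_p$; $\langle w,x\rangle=\sum_n w_nx_n$ is the pairing of $w\in l_q$ with $x\in l_p$; $\theta=(0,0,\ldots)$ denotes the origin of both $l_p$ and $l_q$. For $x\in l_p$, $J(x)$ is the unique element of $l_q$ with $\langle J(x),x\rangle=\|x\|_p^2=\|J(x)\|_q^2$; explicitly $J(\theta)=\theta$ and, for $x\ne\theta$, $J(x)=\left(\frac{|x_n|^{p-1}\operatorname{sign}(x_n)}{\|x\|_p^{p-2}}\right)_{n\ge1}$. The Mordukhovich derivative (coderivative) of $J$ at $(x,J(x))$ is the set-valued mapping $\widehat{D}^*J(x):l_p\rightrightarrows l_q$ defined, for $y\in l_p$, by $$\widehat{D}^*J(x)(y)=\left\{w\in l_q:\ \limsup_{z\to x}\frac{\langle w,z-x\rangle-\langle J(z)-J(x),y\rangle}{\|z-x\|_p+\|J(z)-J(x)\|_q}\le 0\right\},$$ where $z\to x$ in the norm of $l_p$ with $z\neq x$. *)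

(* Defs.v *)
From HB Require Import structures.
From mathcomp Require Import all_boot all_order all_algebra.
From mathcomp Require Import finmap.
From mathcomp Require Import all_classical all_reals all_analysis.
Set Implicit Arguments.
Unset Strict Implicit.
Unset Printing Implicit Defensive.
Import Order.TTheory GRing.Theory Num.Theory.
Import numFieldNormedType.Exports.
Local Open Scope classical_set_scope.
Local Open Scope ring_scope.

Lemma gt1_ge1_EFin (R : realType) (p : R) : 1 < p -> (1 <= p%:E)%E.
Proof. by move=> /ltW; rewrite lee_fin. Qed.

(* Every function out of [nat] is measurable and the only null set of the
   counting measure is empty, so [LfunType], which is not quotiented by a.e.
   equality, is exactly the space of p-summable sequences. *)
Definition ell (R : realType) (p : R) (p1 : 1 < p) : Type :=
  LfunType (@counting nat R) (gt1_ge1_EFin p1).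

Section ell_normed.
Context (R : realType) (p : R) (p1 : 1 < p).

HB.instance Definition _ := GRing.Lmodule.copy (ell p1)
  (LfunType (@counting nat R) (gt1_ge1_EFin p1)).

Definition ell_seq (x : ell p1) : nat -> R :=
  (x : LfunType (@counting nat R) (gt1_ge1_EFin p1)).

Definition ell_norm (x : ell p1) : R :=
  fine 'N[@counting nat R]_(p%:E)[EFin \o ell_seq x]%E.

Lemma ell_normD (x y : ell p1) : ell_norm (x + y) <= ell_norm x + ell_norm y.
Proof. exact: ler_LnormD. Qed.

Lemma ell_normZ (a : R) (x : ell p1) : ell_norm (a *: x) = `|a| * ell_norm x.
Proof.
have nE (y : ell p1) :
    (ell_norm y)%:E = 'N[@counting nat R]_(p%:E)[EFin \o ell_seq y]%E.
  exact: finite_norm_fine.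
by apply: EFin_inj; rewrite EFinM !nE; exact: LnormZ.
Qed.

Lemma ell_norm_eq0 (x : ell p1) : ell_norm x = 0 -> x = 0.
Proof.
move=> /(@fine_Lnormr_eq0 _ _ _ (@counting nat R)) -[A [_ A0 sA]].
apply/LfuneqP => n.
apply: contrapT => xn; have An : A n by apply: sA => /= /(_ I).
move: A0; rewrite /= /counting; case: asboolP => // finA /eqP.
rewrite eqe pnatr_eq0 cardfs_eq0 => /eqP A0.
by move: An; rewrite -(fset_setK finA) A0.
Qed.

HB.instance Definition _ :=
  @Lmodule_isNormed.Build R (ell p1) ell_norm ell_normD ell_normZ ell_norm_eq0.

End ell_normed.
Coercion ell_seq : ell >-> Funclass.

Lemma ell_normE (R : realType) (p : R) (p1 : 1 < p) (x : ell p1) :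
  (`|x|)%:E = ((\sum_(k <oo) ((`|x k| `^ p)%:E)) `^ p^-1)%E.
Proof.
have -> : (`|x|)%:E = 'N[@counting nat R]_(p%:E)[EFin \o x]%E.
  exact: finite_norm_fine.
by rewrite Lnorm_counting// (lt_trans _ p1).
Qed.

(* For conjugate exponents the series converges absolutely (Hoelder). *)
Definition pairing (R : realType) (p q : R) (p1 : 1 < p) (q1 : 1 < q)
    (w : ell q1) (x : ell p1) : R :=
  limn (series (fun n => w n * x n)).

Definition duality_set (R : realType) (p q : R) (p1 : 1 < p) (q1 : 1 < q)
    (x : ell p1) : set (ell q1) :=
  [set j | pairing j x = `|x| ^+ 2 /\ `|x| ^+ 2 = `|j| ^+ 2].

(* For conjugate exponents [duality_set q1 x] is a singleton, so the default
   value 0 of [xget] plays no role. *)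
Definition duality_map (R : realType) (p q : R) (p1 : 1 < p) (q1 : 1 < q)
    (x : ell p1) : ell q1 := xget 0 (@duality_set R p q p1 q1 x).

(* [x^'] is the filter of deleted neighborhoods of [x] for the norm of
   [ell p1]. *)
Definition coderivative (R : realType) (p q : R) (p1 : 1 < p) (q1 : 1 < q)
    (f : ell p1 -> ell q1) (x y : ell p1) : set (ell q1) :=
  [set w | (limf_esup (fun z : ell p1 =>
     ((pairing w (z - x) - pairing (f z - f x) y)
      / (`|z - x| + `|f z - f x|))%:E) x^' <= 0)%E].

Arguments duality_set {R p q p1} q1 x.
Arguments duality_map {R p q p1} q1 x.
Arguments coderivative {R p q p1 q1} f x y.

(* Main.v *)
Require Import Defs.
From HB Require Import structures.
From mathcomp Require Import all_boot all_order all_algebra.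
From mathcomp Require Import all_classical all_reals all_analysis.
From mathcomp Require Import ring lra.
Import Order.TTheory GRing.Theory Num.Theory.
Import numFieldNormedType.Exports.
Local Open Scope classical_set_scope.
Local Open Scope ring_scope.

(** The coderivative condition already fails along the ray through [x]. The
duality map is homogeneous there ([duality_mapZ]), so for [z = (1 + t) x] one
has [z - x = t x] and [J z - J x = t (J x)], and the quotient for
[w = a (J x)] and [y = x] equals
  [(a t |x|^2 - t |x|^2) / (|t| |x| + |t| |x|) = (a - 1) t |x| / (2 |t|)].
When [t] has the sign of [a - 1] this is the positive constant
[|a - 1| |x| / 2], attained in every punctured neighborhood of [x]; hence the
limsup is positive.

Since [J] is defined by choosing an element of [duality_set], homogeneity
rests on existence and uniqueness of that element when [x] is nonzero
([duality_set_singleton]). By scaling one may take [|x| = 1]. A dual element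
[j] then satisfies [sum j_n x_n = 1 = sum |j_n|^q / q + sum |x_n|^p / p], so
Young's inequality is an equality for each [n], and its equality case
([young_eq]) forces [j_n = sg(x_n) |x_n|^(p-1)]. Conversely this sequence lies
in [l_q] because its [q]-th powers are the [|x_n|^p]
([normr_sg_powR_conjugate]). *)

(** * Young's inequality: the case of equality *)

Lemma conjugate_mulrE {R : realType} {p q : R} (p1 : 1 < p) (q1 : 1 < q) :
  p^-1 + q^-1 = 1 -> p * q = p + q.
Proof. by move=> pq; rewrite -[LHS]mulr1 -pq; field; rewrite !gt_eqF//; lra. Qed.

(** For positive [a] and [b], put [m = ln a + ln b]. The tangent bound
[exp m * (1 + (s - m)) <= exp s] at [s = q ln a] and [s = p ln b], averaged
with weights [1/q] and [1/p], is Young's inequality. The bound is strict for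
[s <> m], so equality forces [q ln a = m]. *)
Lemma young_eq_ge0 {R : realType} {p q a b : R} (p1 : 1 < p) (q1 : 1 < q)
    (pq : p^-1 + q^-1 = 1) :
  0 <= a -> 0 <= b -> a * b = a `^ q / q + b `^ p / p -> a = b `^ (p - 1).
Proof.
have p0 : 0 < p by lra.
have q0 : 0 < q by lra.
move=> a0 b0 ab.
have [b0'|bn0] := eqVneq b 0.
  move: ab; rewrite b0' mulr0 !powR0 ?gt_eqF ?subr_gt0// mul0r addr0 => /esym.
  by move/eqP; rewrite mulf_eq0 invr_eq0 (gt_eqF q0) orbF => /eqP/powR_eq0_eq0.
have {b0 bn0} b0 : 0 < b by rewrite lt_neqAle eq_sym bn0.
have [a0'|an0] := eqVneq a 0.
  move: ab; rewrite a0' mul0r powR0 ?gt_eqF// mul0r add0r => /esym/eqP.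
  by rewrite mulf_eq0 invr_eq0 (gt_eqF p0) orbF gt_eqF// powR_gt0.
have {a0 an0} a0 : 0 < a by rewrite lt_neqAle eq_sym an0.
set m := ln a + ln b.
have abE : a * b = expR m by rewrite expRD !lnK.
have aE : a `^ q = expR m * expR (q * ln a - m).
  by rewrite -expRD /powR gt_eqF// addrC subrK.
have bE : b `^ p = expR m * expR (p * ln b - m).
  by rewrite -expRD /powR gt_eqF// addrC subrK.
have em : 0 < expR m := expR_gt0 m.
have [sm|sm] := eqVneq (q * ln a - m) 0.
  (* here (q - 1) ln a = ln b, and p - 1 is the inverse of q - 1 *)
  have E : ln a = (p - 1) * ln b.
    have pqE := conjugate_mulrE p1 q1 pq.
    have /(congr1 (fun z => (p - 1) * z)) : (q - 1) * ln a = ln b.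
      by move: sm; rewrite /m; lra.
    rewrite mulrA; have -> : (p - 1) * (q - 1) = 1 by lra.
    by rewrite mul1r.
  by rewrite /powR gt_eqF// -E lnK.
suff : a * b < a `^ q / q + b `^ p / p by rewrite ab ltxx.
rewrite abE aE bE -!mulrA -mulrDr -[X in X < _]mulr1 ltr_pM2l//.
have h1 : (1 + (q * ln a - m)) / q < expR (q * ln a - m) / q.
  by rewrite ltr_pM2r ?invr_gt0// expR_gt1Dx.
have h2 : (1 + (p * ln b - m)) / p <= expR (p * ln b - m) / p.
  by rewrite ler_pM2r ?invr_gt0// expR_ge1Dx.
apply: le_lt_trans (ltr_leD h1 h2).
have -> : (1 + (q * ln a - m)) / q + (1 + (p * ln b - m)) / p =
  (p^-1 + q^-1) * (1 - m) + (ln a + ln b).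
  by field; rewrite !gt_eqF.
by rewrite pq /m; lra.
Qed.

(** Since [u * x <= |u| * |x|], equality for [u] and [x] gives equality for
their absolute values, and moreover [u] has the sign of [x]. *)
Lemma young_eq {R : realType} {p q u x : R} (p1 : 1 < p) (q1 : 1 < q)
    (pq : p^-1 + q^-1 = 1) :
  u * x = `|u| `^ q / q + `|x| `^ p / p -> u = Num.sg x * `|x| `^ (p - 1).
Proof.
move=> ux.
have p0 : 0 < p by lra.
have q0 : 0 < q by lra.
have aux : `|u| * `|x| = `|u| `^ q / q + `|x| `^ p / p.
  apply/le_anti; rewrite conjugate_powR//; last by rewrite addrC.
  by rewrite -ux -normrM ler_norm.
have <- := young_eq_ge0 p1 q1 pq (normr_ge0 _) (normr_ge0 _) aux.
move: ux; rewrite -aux; have [x0|x0|x0] := ltgtP x 0.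
- rewrite (ltr0_sg x0) (ltr0_norm x0) => e; have xn : x != 0 by rewrite lt_eqF.
  by apply: (mulIf xn); rewrite e; ring.
- by rewrite (gtr0_sg x0) (gtr0_norm x0) mul1r; apply: mulIf; rewrite gt_eqF.
- move=> _; move: aux.
  rewrite x0 sgr0 mul0r normr0 mulr0 powR0 ?gt_eqF// mul0r addr0 => /esym/eqP.
  rewrite mulf_eq0 invr_eq0 (gt_eqF q0) orbF => /eqP.
  by move/powR_eq0_eq0/eqP; rewrite normr_eq0 => /eqP.
Qed.

(** This is [(p - 1) q = p] for conjugate exponents. *)
Lemma normr_sg_powR_conjugate {R : realType} {p q : R} (p1 : 1 < p) (q1 : 1 < q)
    (pq : p^-1 + q^-1 = 1) (x : R) :
  `|Num.sg x * `|x| `^ (p - 1)| `^ q = `|x| `^ p.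
Proof.
have p0 : 0 < p by lra.
have q0 : 0 < q by lra.
rewrite normrM normr_sg (ger0_norm (powR_ge0 _ _)).
have [->|xn] := eqVneq x 0; first by rewrite mul0r normr0 !powR0 ?gt_eqF.
rewrite mul1r -powRrM; congr (_ `^ _).
by have := conjugate_mulrE p1 q1 pq; lra.
Qed.

(** * Norm and pairing as real series *)

Lemma ell_norm_cvg {R : realType} {p : R} {p1 : 1 < p} (x : ell p1) :
  series (fun n => `|x n| `^ p) @ \oo --> `|x| `^ p.
Proof.
have p0 : 0 < p by lra.
have S : (`|x| `^ p)%:E = (\sum_(k <oo) ((`|x k| `^ p)%:E))%E.
  rewrite -poweR_EFin ell_normE -poweRrM mulVf ?gt_eqF// poweRe1//.
  by apply: nneseries_ge0 => *; rewrite lee_fin powR_ge0.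
have c : cvgn (series (fun n => `|x n| `^ p)).
  by apply: nnseries_is_cvg => [n|]; rewrite ?powR_ge0// -S ltry.
suff -> : `|x| `^ p = limn (series (fun n => `|x n| `^ p)) by [].
apply: EFin_inj; rewrite S -EFin_lim//; congr (limn _).
by apply/funext => n /=; rewrite /series/= sumEFin.
Qed.

Lemma ell_of_summable {R : realType} {p : R} (p1 : 1 < p) (u : nat -> R) :
  cvgn (series (fun n => `|u n| `^ p)) -> exists x : ell p1, x =1 u.
Proof.
move=> c; have p0 : 0 < p by lra.
have uL : u \in Lfun (@counting nat R) p%:E.
  rewrite inE/=; apply/andP; split; rewrite inE/=; first by move=> ? ? ?.
  rewrite /finite_norm Lnorm_counting// poweR_lty//.
  have -> : (\sum_(k <oo) (`|(EFin \o u) k| `^ p) =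
     (limn (series (fun n => `|u n| `^ p)))%:E)%E.
    rewrite -EFin_lim//; congr (limn _).
    by apply/funext => n /=; rewrite /series/= -sumEFin.
  exact: ltry.
by exists (Lfun_Sub (gt1_ge1_EFin p1) uL) => n.
Qed.

(** Termwise Young's inequality dominates [|w_n x_n|] by a summable sequence. *)
Lemma pairing_is_cvg {R : realType} {p q : R} {p1 : 1 < p} {q1 : 1 < q}
    (pq : p^-1 + q^-1 = 1) (w : ell q1) (x : ell p1) :
  cvgn (series (fun n => w n * x n)).
Proof.
have p0 : 0 < p by lra.
have q0 : 0 < q by lra.
apply: normed_cvg; apply: (@series_le_cvg _ _
  (q^-1 *: (fun n => `|w n| `^ q) + p^-1 *: (fun n => `|x n| `^ p))) => [n|n|n|].
- exact: normr_ge0.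
- by rewrite addr_ge0// mulr_ge0 ?invr_ge0 ?powR_ge0// ltW.
- rewrite /= normrM.
  apply: le_trans (_ : `|w n| `^ q / q + `|x n| `^ p / p <= _).
    by rewrite conjugate_powR// addrC.
  by rewrite [X in X + _ <= _]mulrC [X in _ + X <= _]mulrC.
- by apply: is_cvg_seriesD; apply: is_cvg_seriesZ; apply: cvgP;
    exact: ell_norm_cvg.
Qed.

Lemma pairingZ {R : realType} {p q : R} {p1 : 1 < p} {q1 : 1 < q}
    (pq : p^-1 + q^-1 = 1) (b c : R) (w : ell q1) (x : ell p1) :
  pairing (b *: w) (c *: x) = b * c * pairing w x.
Proof.
rewrite /pairing -[RHS](lim_seriesZ (b * c)); last exact: pairing_is_cvg.
by congr (limn (series _)); apply/funext => n; exact: mulrACA.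
Qed.

Lemma series_ge0_lim0 {R : realType} {e : nat -> R} :
  (forall n, 0 <= e n) -> series e @ \oo --> 0 -> forall n, e n = 0.
Proof.
move=> e0 ec n; apply/le_anti; rewrite e0 andbT.
have nd : nondecreasing_seq (series e).
  by apply/nondecreasing_seqP => k; rewrite /series/= big_nat_recr//= lerDl.
have := nondecreasing_cvgn_le nd (cvgP _ ec) n.+1.
rewrite (cvg_lim _ ec)//; apply: le_trans.
by rewrite /series/= big_nat_recr//= lerDr sumr_ge0.
Qed.

(** * The duality map of a nonzero vector *)

Lemma duality_setZ {R : realType} {p q : R} {p1 : 1 < p} {q1 : 1 < q}
    (pq : p^-1 + q^-1 = 1) (c : R) {x : ell p1} {j : ell q1} :
  duality_set q1 x j -> duality_set q1 (c *: x) (c *: j).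
Proof.
move=> [jx xj]; split; rewrite ?pairingZ// !normrZ !exprMn.
  by rewrite jx -expr2 real_normK ?num_real.
by rewrite xj.
Qed.

Lemma powR_eq1 {R : realType} (r y : R) :
  0 < r -> 0 <= y -> y `^ r = 1 -> y = 1.
Proof.
move=> r0 y0 e; have := congr1 (fun z => z `^ r^-1) e.
by rewrite -powRrM mulfV ?gt_eqF// powRr1// powR1.
Qed.

(** For dual unit vectors the gaps in Young's inequality are nonnegative and
sum to [1/q + 1/p - 1 = 0], so they all vanish. *)
Lemma duality_set_unit {R : realType} {p q : R} {p1 : 1 < p} {q1 : 1 < q}
    (pq : p^-1 + q^-1 = 1) {x : ell p1} {j : ell q1} : `|x| = 1 ->
  duality_set q1 x j <-> forall n, j n = Num.sg (x n) * `|x n| `^ (p - 1).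
Proof.
have p0 : 0 < p by lra.
have q0 : 0 < q by lra.
move=> x1; have cx := ell_norm_cvg x; have cj := ell_norm_cvg j.
rewrite x1 powR1 in cx; split.
  move=> [jx]; rewrite x1 expr1n => /esym/eqP.
  rewrite sqrf_eq1 => /orP[|]/eqP j1; last first.
    by have := normr_ge0 j; rewrite j1; lra.
  rewrite j1 powR1 in cj.
  have cjx : series (fun n => j n * x n) @ \oo --> (1 : R).
    by rewrite -(expr1n _ 2) -x1 -jx; exact: pairing_is_cvg.
  move=> n; apply: (young_eq p1 q1 pq); apply/eqP; rewrite eq_sym -subr_eq0.
  apply/eqP; move: n; apply: series_ge0_lim0 => [n|].
    rewrite subr_ge0; apply: le_trans (ler_norm _) _; rewrite normrM.
    by rewrite conjugate_powR// addrC.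
  have -> : 0 = q^-1 * 1 + p^-1 * 1 - 1 :> R by lra.
  have -> : series (fun n => `|j n| `^ q / q + `|x n| `^ p / p - j n * x n) =
      q^-1 *: series (fun n => `|j n| `^ q) +
      p^-1 *: series (fun n => `|x n| `^ p) - series (fun n => j n * x n).
    apply/funext => n; rewrite /series/= !fctE /= sumrB big_split/=.
    by rewrite /GRing.scale/= !mulr_sumr; congr (_ + _ - _);
      apply: eq_bigr => i _; rewrite mulrC.
  by apply: cvgB => //; apply: cvgD; apply: cvgZr.
move=> jE.
have jn n : `|j n| `^ q = `|x n| `^ p.
  by rewrite jE normr_sg_powR_conjugate.
have j1 : `|j| = 1.
  apply: (powR_eq1 q) => //.
  rewrite (_ : (fun n => `|j n| `^ q) = (fun n => `|x n| `^ p)) in cj;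
    last exact/funext.
  exact: (cvg_unique _ cj cx).
split; last by rewrite x1 j1.
rewrite x1 expr1n /pairing; apply: cvg_lim => //.
rewrite (_ : (fun n => j n * x n) = (fun n => `|x n| `^ p))//.
apply/funext => n; rewrite jE mulrAC mulrC -normrEsg.
have [->|xn] := eqVneq (x n) 0; first by rewrite normr0 mulr0 powR0 ?gt_eqF.
rewrite -[X in _ * X]powRr1// -powRD; last by rewrite normr_eq0 xn implybT.
by congr (_ `^ _); ring.
Qed.

Lemma duality_set_singleton {R : realType} {p q : R} {p1 : 1 < p} (q1 : 1 < q)
    (pq : p^-1 + q^-1 = 1) {x : ell p1} (x0 : x <> 0) :
  exists j, duality_set q1 x = [set j].
Proof.
have N0 : `|x| != 0 by rewrite normr_eq0; apply/eqP.
have x'1 : `| `|x|^-1 *: x| = 1 by rewrite normrZ normfV normr_id mulVf.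
set x' := `|x|^-1 *: x in x'1.
have xE : x = `|x| *: x' by rewrite scalerA mulfV// scale1r.
have [|j jE] :=
    ell_of_summable q1 (fun n => Num.sg (x' n) * `|x' n| `^ (p - 1)).
  rewrite (_ : (fun n => _) = (fun n => `|x' n| `^ p)).
    exact: cvgP (ell_norm_cvg x').
  by apply/funext => n; rewrite normr_sg_powR_conjugate.
have jD : duality_set q1 x' j by apply/duality_set_unit.
exists (`|x| *: j); apply/seteqP; split => [k kD|k ->]; last first.
  by rewrite [in X in X _]xE; apply: duality_setZ.
have /(duality_set_unit pq x'1) kE : duality_set q1 x' (`|x|^-1 *: k).
  exact: duality_setZ.
have <- : `|x|^-1 *: k = j by apply/LfuneqP => n; rewrite [RHS]jE [LHS]kE.
by rewrite /= scalerA mulfV// scale1r.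
Qed.

Lemma duality_mapP {R : realType} {p q : R} {p1 : 1 < p} {q1 : 1 < q}
    (pq : p^-1 + q^-1 = 1) {x : ell p1} (x0 : x <> 0) (j : ell q1) :
  duality_set q1 x j <-> j = duality_map q1 x.
Proof.
have [k E] := duality_set_singleton q1 pq x0.
by rewrite /duality_map E (@xget_unique _ 0 [set k] k).
Qed.

Lemma duality_mapZ {R : realType} {p q : R} {p1 : 1 < p} {q1 : 1 < q}
    (pq : p^-1 + q^-1 = 1) {x : ell p1} (x0 : x <> 0) {c : R} : c != 0 ->
  duality_map q1 (c *: x) = c *: duality_map q1 x.
Proof.
move=> c0; apply/esym/duality_mapP => //.
  by move/eqP; rewrite scaler_eq0 (negPf c0) => /eqP.
by apply: duality_setZ => //; apply/duality_mapP.
Qed.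

(** * The coderivative along the ray through the base point *)

Theorem theorem3p3 (R : realType) (p q : R) (p1 : 1 < p) (q1 : 1 < q)
    (pq : p^-1 + q^-1 = 1) (x : ell p1) (x0 : x <> 0)
    (a : R) (a0 : 0 < a) (a1 : a <> 1) :
  ~ coderivative (duality_map q1) x x (a *: duality_map q1 x).
Proof.
have N0 : 0 < `|x| by rewrite normr_gt0; apply/eqP.
have a1' : 0 < `|a - 1| by rewrite normr_gt0 subr_eq0; apply/eqP.
set J := duality_map q1 x.
have [Jx NJ] : duality_set q1 x J by apply/duality_mapP.
have JN : `|J| = `|x| by apply/eqP; rewrite -(@eqrXn2 _ 2)// NJ.
rewrite /coderivative /=; apply/negP; rewrite -ltNge.
apply: (@lt_le_trans _ _ (`|a - 1| * `|x| / 2)%:E).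
  by rewrite lte_fin divr_gt0// mulr_gt0.
apply/ereal_infP => _ [V xV <-].
move: xV; rewrite /dnbhs /within /= => /nbhs_ballP [e /= e0 eV].
(* The bound e / (2 |x|) keeps (1 + t) x in the ball of radius e around x, and
   r < 1 makes the scaling factor 1 + t nonzero. *)
pose r := Num.min (1 / 2) (e / (2 * `|x|)).
have r0 : 0 < r by rewrite lt_min divr_gt0//= divr_gt0// mulr_gt0.
have r1 : r < 1 by rewrite gt_min; apply/orP; left; lra.
have re : r * `|x| < e.
  apply: (@le_lt_trans _ _ (e / (2 * `|x|) * `|x|)).
    by rewrite ler_pM2r// ge_min lexx orbT.
  have -> : e / (2 * `|x|) * `|x| = e / 2 by field; rewrite gt_eqF.
  lra.
have [t tN tE] : exists2 t : R, `|t| = r & (a - 1) * t = `|a - 1| * r.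
  exists (Num.sg (a - 1) * r); last by rewrite mulrA [X in X * r]mulrC -normrEsg.
  by rewrite normrM normr_sg -normr_gt0 a1' mul1r gtr0_norm.
have t0 : t != 0 by rewrite -normr_eq0 tN gt_eqF.
have t1 : 1 + t != 0.
  rewrite addrC addr_eq0; apply/eqP => tm1.
  by move: r1; rewrite -tN tm1 normrN1 ltxx.
have zx : (1 + t) *: x - x = t *: x by rewrite scalerDl scale1r addrC addKr.
have fzx : duality_map q1 ((1 + t) *: x) - J = t *: J.
  by rewrite duality_mapZ// scalerDl scale1r addrC addKr.
apply: ereal_sup_ubound; exists ((1 + t) *: x).
  apply: eV.
    by rewrite -ball_normE/= -normrN opprB zx normrZ tN.
  by rewrite -subr_eq0 zx scaler_eq0 (negPf t0); apply/eqP.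
congr EFin; rewrite fzx zx !normrZ tN JN.
rewrite pairingZ// -[X in _ - pairing _ X]scale1r pairingZ// Jx.
have -> : a * t * `|x| ^+ 2 - t * 1 * `|x| ^+ 2 = (a - 1) * t * `|x| ^+ 2.
  by ring.
rewrite tE.
by field; rewrite gt_eqF// addr_gt0// mulr_gt0.
Qed.
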